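(* Fix an integer $b\geq 2$. For each positive integer $k$, the numbers $0,1,\dots,bk-1$ can be arranged (each used exactly once) in a $b\times k$ matrix $A_k=[a_{i,j}]_{1\le i\le b,\,1\le j\le k}$ such that: (i) $a_{1,j}=j-1$ for $j=1,\dots,k$; (ii) $a_{1,j}\prec_b a_{i,j}$ for $i=1,\dots,b$ and $j=1,\dots,k$; and (iii) $a_{i,j}-a_{1,j}$ is the sum of exactly $i-1$ powers of $b$; that is, $s_b(a_{i,j})=s_b(a_{1,j})+i-1$, for $i=1,\dots,b$ and $j=1,\dots,k$.
   Context: For $n\in\mathbb{Z}_{\ge0}$ write $n=\sum_{i\ge0}\alpha_i(n;b)b^i$ with digits $\alpha_i(n;b)\in\{0,\dots,b-1\}$, and let $s_b(n)=\sum_i\alpha_i(n;b)$. The partial order $\prec_b$ is defined by $n\prec_b m$ iff $\alpha_i(n;b)\leq\alpha_i(m;b)$ for every $i$. A ''power of $b$'' means $b^r$ with $r\in\mathbb{Z}_{\ge0}$ (repetitions allowed in the sum). *)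

(* Defs.v *)
From mathcomp Require Import all_boot all_order all_algebra.

Set Implicit Arguments.
Unset Strict Implicit.
Unset Printing Implicit Defensive.

Definition digit (b n i : nat) : nat := (n %/ b ^ i) %% b.

(* The range i < n covers every nonzero digit: for b >= 2, i < b ^ i, so
   n <= i forces n %/ b ^ i = 0. *)
Definition digit_sum (b n : nat) : nat := \sum_(i < n) digit b n i.

Definition digit_le (b n m : nat) : Prop :=
  forall i : nat, digit b n i <= digit b m i.

(* r lists the exponents, so the same power may be used several times. *)
Definition sum_of_powers (b c n : nat) : Prop :=
  exists2 r : seq nat, size r = c & n = \sum_(e <- r) b ^ e.

Definition first_row (b : nat) (hb : 2 <= b) : 'I_b := Ordinal (ltnW hb).

(* Main.v *)
Require Import Defs.
From mathcomp Require Import all_boot all_order all_algebra.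
From mathcomp Require Import zify.

Set Implicit Arguments.
Unset Strict Implicit.
Unset Printing Implicit Defensive.

(* Reading the columns one after the other, the matrix becomes a permutation f
   of [0, N), N = b * k, such that f p dominates p %/ b digitwise, with total
   excess p %% b.  Such an f exists for every N.  For each last digit e, take by
   induction an arrangement of the m with m * b + e < N: its entry at position
   q * b + u, with the last digit e appended, is suitable for the position
   (q * b + c) * b + i as soon as c <= e and u + e = c + i.  Hence all that is
   needed is a permutation (c, i) |-> (u, e) of the last two digits of the
   positions below N.  Exchange the two digits, (u, e) = (i, c), when the
   resulting position is below N.  Otherwise keep them, (u, e) = (c, i): then
   the exchange would increase the position, so that c <= i. *)

Lemma divnMDl_small q d r : r < d -> (q * d + r) %/ d = q.
Proof. by move=> rd; rewrite divnMDl ?divn_small ?addn0 //; case: d rd. Qed.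

Lemma modnMDl_small q d r : r < d -> (q * d + r) %% d = r.
Proof. by move=> rd; rewrite modnMDl modn_small. Qed.

Lemma eq_divn_modn d m n : m %/ d = n %/ d -> m %% d = n %% d -> m = n.
Proof.
by move=> eq_div eq_mod; rewrite (divn_eq m d) eq_div eq_mod -divn_eq.
Qed.

Lemma perm_eq_image_iota (T : finType) (f : T -> nat) :
  injective f -> (forall x, f x < #|T|) -> perm_eq (image f T) (iota 0 #|T|).
Proof.
move=> f_inj f_lt.
have image_uniq : uniq (image f T) by rewrite map_inj_uniq ?enum_uniq.
have image_sub : {subset image f T <= iota 0 #|T|}.
  by move=> _ /mapP[x _ ->]; rewrite mem_iota f_lt.
have size_ge : size (iota 0 #|T|) <= size (image f T).
  by rewrite size_iota size_map -cardE.
have [_ mem_image] := uniq_min_size image_uniq image_sub size_ge.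
by apply: uniq_perm; rewrite ?iota_uniq.
Qed.

Lemma digit0 b n : digit b n 0 = n %% b.
Proof. by rewrite /digit divn1. Qed.

Lemma digitS b n i : digit b n i.+1 = digit b (n %/ b) i.
Proof. by rewrite /digit expnS divnMA. Qed.

Lemma digit_small b n i : n < b ^ i -> digit b n i = 0.
Proof. by move=> n_lt; rewrite /digit divn_small ?mod0n. Qed.

Lemma digit_expansion b n B : n < b ^ B -> n = \sum_(i < B) digit b n i * b ^ i.
Proof.
elim: B n => [|B IH] n n_lt; first by rewrite big_ord0; case: n n_lt.
rewrite big_ord_recl digit0 muln1 addnC.
under eq_bigr => i _ do rewrite /= digitS expnSr mulnA.
rewrite -big_distrl -IH -?divn_eq //=.
have b_gt0 : 0 < b by move: n_lt; rewrite expnS; case: (b).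
by rewrite ltn_divLR -?expnSr.
Qed.

Lemma digit_sum_widen b n B :
  2 <= b -> n <= B -> digit_sum b n = \sum_(i < B) digit b n i.
Proof.
move=> b_ge2 nB; rewrite /digit_sum (big_ord_widen B (digit b n)) //.
rewrite big_mkcond; apply: eq_bigr => i _ /=; case: ltnP => // ni.
by rewrite (digit_small (leq_ltn_trans ni (ltn_expl i b_ge2))).
Qed.

Lemma digit_sum_rec b n :
  2 <= b -> digit_sum b n = n %% b + digit_sum b (n %/ b).
Proof.
move=> b_ge2; rewrite (digit_sum_widen b_ge2 (leqnSn n)) big_ord_recl digit0.
rewrite (digit_sum_widen b_ge2 (leq_div n b)).
by under eq_bigr => i _ do rewrite /= digitS.
Qed.

Lemma digit_le_rec b n m :
  n %% b <= m %% b -> digit_le b (n %/ b) (m %/ b) -> digit_le b n m.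
Proof. by move=> le_mod le_div [|i]; rewrite ?digit0 ?digitS. Qed.

Lemma digit_le_leq b n m : 2 <= b -> digit_le b n m -> n <= m.
Proof.
move=> b_ge2 le_nm; have lt_expn x y : x <= y -> x < b ^ y.
  by move=> xy; exact: leq_ltn_trans xy (ltn_expl y b_ge2).
rewrite (digit_expansion (lt_expn _ _ (leq_maxl n m))).
rewrite [leqRHS](digit_expansion (lt_expn _ _ (leq_maxr n m))).
by apply: leq_sum => i _; rewrite leq_mul2r le_nm orbT.
Qed.

Lemma sum_of_powers_weighted_sum b B (d : nat -> nat) :
  sum_of_powers b (\sum_(i < B) d i) (\sum_(i < B) d i * b ^ i).
Proof.
elim: B => [|B [r size_r sum_r]].
  by exists [::]; rewrite ?big_nil ?big_ord0.
exists (r ++ nseq (d B) B).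
  by rewrite size_cat size_nseq size_r big_ord_recr.
by rewrite big_cat big_nseq iter_addn_0 -sum_r big_ord_recr /= mulnC.
Qed.

Lemma digit_le_sum_of_powers b n m :
  2 <= b -> digit_le b n m ->
  sum_of_powers b (digit_sum b m - digit_sum b n) (m - n).
Proof.
move=> b_ge2 le_nm; have nm := digit_le_leq b_ge2 le_nm.
have m_lt : m < b ^ m by rewrite ltn_expl.
have -> : m - n = \sum_(i < m) (digit b m i - digit b n i) * b ^ i.
  rewrite [in LHS](digit_expansion m_lt).
  rewrite [in LHS](digit_expansion (leq_ltn_trans nm m_lt)).
  rewrite -sumnB => [|i _]; last by rewrite leq_mul.
  by under eq_bigr do rewrite -mulnBl.
rewrite (digit_sum_widen b_ge2 (leqnn m)) (digit_sum_widen b_ge2 nm) -sumnB //.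
exact: (sum_of_powers_weighted_sum _ _ (fun i => digit b m i - digit b n i)).
Qed.

Definition digit_excess (b n m i : nat) : Prop :=
  digit_le b n m /\ digit_sum b m = digit_sum b n + i.

Lemma digit_excess_refl b n : digit_excess b n n 0.
Proof. by split=> [i|]; rewrite ?addn0. Qed.

Lemma digit_excess_rec b n m i :
  2 <= b -> n %% b <= m %% b -> digit_excess b (n %/ b) (m %/ b) i ->
  digit_excess b n m (i + (m %% b - n %% b)).
Proof.
move=> b_ge2 le_mod [le_div sum_div]; split; first exact: digit_le_rec.
by rewrite (digit_sum_rec m b_ge2) (digit_sum_rec n b_ge2) sum_div; lia.
Qed.

Lemma digit_excess_sum_of_powers b n m i :
  2 <= b -> digit_excess b n m i -> sum_of_powers b i (m - n).
Proof.
move=> b_ge2 [le_nm sum_m]; rewrite -(addKn (digit_sum b n) i) -sum_m.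
exact: digit_le_sum_of_powers.
Qed.

Lemma digit_excess0_eq b n m : 2 <= b -> digit_excess b n m 0 -> m = n.
Proof.
move=> b_ge2 excess0; have nm := digit_le_leq b_ge2 (proj1 excess0).
have [r /size0nil->] := digit_excess_sum_of_powers b_ge2 excess0.
by rewrite big_nil => /eqP mn; apply/eqP; rewrite eqn_leq nm andbT.
Qed.

Definition swap_last_digits (b p : nat) : nat :=
  (p %/ b %/ b * b + p %% b) * b + p %/ b %% b.

Section SwapLastDigits.

Variable b : nat.
Hypothesis b_gt0 : 0 < b.

Let ltn_modb p : p %% b < b. Proof. by rewrite ltn_mod. Qed.

Lemma swap_last_digits_modn p : swap_last_digits b p %% b = p %/ b %% b.
Proof. by rewrite modnMDl_small. Qed.

Lemma swap_last_digits_divn p :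
  swap_last_digits b p %/ b = p %/ b %/ b * b + p %% b.
Proof. by rewrite divnMDl_small. Qed.

Lemma swap_last_digitsK : involutive (swap_last_digits b).
Proof.
move=> p; rewrite [LHS]/swap_last_digits swap_last_digits_modn.
by rewrite swap_last_digits_divn divnMDl_small ?modnMDl_small // -!divn_eq.
Qed.

Lemma leq_swap_last_digits p :
  (p <= swap_last_digits b p) = (p %/ b %% b <= p %% b).
Proof.
rewrite /swap_last_digits [leqLHS](divn_eq p b) [p %/ b in leqLHS](divn_eq _ b).
have := ltn_modb p; have := ltn_modb (p %/ b).
move: (p %/ b %/ b) (p %/ b %% b) (p %% b) => q c i c_lt i_lt.
by apply/idP/idP; nia.
Qed.

Variable N : nat.

Definition swap_below (p : nat) : nat :=
  if swap_last_digits b p < N then swap_last_digits b p else p.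

Lemma swap_below_lt p : p < N -> swap_below p < N.
Proof. by rewrite /swap_below; case: ifP. Qed.

Lemma swap_belowK : {in gtn N, cancel swap_below swap_below}.
Proof.
move=> p; rewrite inE /swap_below => pN.
case: (boolP (swap_last_digits b p < N)) => [_|/negbTE-> //].
by rewrite swap_last_digitsK pN.
Qed.

Lemma swap_belowP p (p' := swap_below p) :
  p < N ->
  [/\ p' %/ b %/ b = p %/ b %/ b, p %/ b %% b <= p' %% b
    & p' %/ b %% b + p' %% b = p %/ b %% b + p %% b].
Proof.
move=> pN; rewrite /p' /swap_below; case: ltnP => [_|N_le].
  rewrite swap_last_digits_modn swap_last_digits_divn.
  by rewrite divnMDl_small ?modnMDl_small // addnC.
by split=> //; rewrite -leq_swap_last_digits (leq_trans (ltnW pN)).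
Qed.

End SwapLastDigits.

Definition num_prefixes (b N e : nat) : nat := (N + b.-1 - e) %/ b.

Lemma ltn_num_prefixes b N m e :
  e < b -> (m < num_prefixes b N e) = (m * b + e < N).
Proof. by move=> eb; rewrite leq_divRL ?mulSn; lia. Qed.

Lemma num_prefixes_leq_expn b N d e :
  0 < b -> N <= b ^ d.+1 -> num_prefixes b N e <= b ^ d.
Proof.
move=> b_gt0 N_le; rewrite /num_prefixes -ltnS ltn_divLR // mulSn -expnSr; lia.
Qed.

Fixpoint arrangement (b d N p : nat) : nat :=
  if d is d'.+1 then
    let p' := swap_below b N p in
    let e := p' %% b in
    arrangement b d' (num_prefixes b N e) (p' %/ b) * b + e
  else p.

Lemma swap_below_divn_lt b N p (p' := swap_below b N p) :
  0 < b -> p < N -> p' %/ b < num_prefixes b N (p' %% b).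
Proof.
move=> b_gt0 pN; rewrite ltn_num_prefixes ?ltn_mod // -divn_eq.
exact: swap_below_lt.
Qed.

Lemma arrangement_lt b d N p : 0 < b -> p < N -> arrangement b d N p < N.
Proof.
move=> b_gt0; elim: d N p => [//|d IH] N p pN /=.
by rewrite -ltn_num_prefixes ?ltn_mod // IH // swap_below_divn_lt.
Qed.

Lemma arrangement_inj b d N :
  0 < b -> {in gtn N &, injective (arrangement b d N)}.
Proof.
move=> b_gt0; elim: d N => [|d IH] N p1 p2 // p1N p2N /= eq_arr.
have eq_mod := congr1 (modn^~ b) eq_arr; have := congr1 (divn^~ b) eq_arr.
rewrite /= !modnMDl_small ?ltn_mod // in eq_mod.
rewrite /= !divnMDl_small ?ltn_mod // eq_mod => /IH eq_div.
apply: (can_in_inj (@swap_belowK b b_gt0 N)) => //.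
apply: (eq_divn_modn _ eq_mod); apply: eq_div; last exact: swap_below_divn_lt.
by rewrite inE -eq_mod; exact: swap_below_divn_lt.
Qed.

Lemma arrangement_excess b d N p : 2 <= b -> N <= b ^ d -> p < N ->
  digit_excess b (p %/ b) (arrangement b d N p) (p %% b).
Proof.
move=> b_ge2; have b_gt0 := ltnW b_ge2; elim: d N p => [|d IH] N p N_le pN.
  have -> : p = 0 by move: N_le pN; rewrite expn0; lia.
  by rewrite div0n mod0n; exact: digit_excess_refl.
have [eq_col le_mod eq_sum] := swap_belowP b_gt0 pN.
have p'N := swap_below_divn_lt b_gt0 pN.
rewrite /=; set p' := swap_below b N p in eq_col le_mod eq_sum p'N *.
set m := _ * b + _.
have m_mod : m %% b = p' %% b by rewrite modnMDl_small ?ltn_mod.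
have excess_div : digit_excess b (p %/ b %/ b) (m %/ b) (p' %/ b %% b).
  rewrite divnMDl_small ?ltn_mod // -eq_col.
  by apply: IH; rewrite ?num_prefixes_leq_expn.
have -> : p %% b = p' %/ b %% b + (m %% b - p %/ b %% b).
  by rewrite m_mod addnBA // eq_sum addKn.
by apply: digit_excess_rec; rewrite ?m_mod.
Qed.

Definition column_major_mx (b k : nat) (f : nat -> nat) : 'M[nat]_(b, k) :=
  (\matrix_(i, j) f (j * b + i)%N)%R.

Lemma column_major_lt b k (i : 'I_b) (j : 'I_k) : j * b + i < b * k.
Proof. have := ltn_ord i; have := ltn_ord j; nia. Qed.

Lemma perm_eq_column_major_mx b k f (A := column_major_mx b k f) :
  {in gtn (b * k) &, injective f} -> (forall p, p < b * k -> f p < b * k) ->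
  perm_eq [seq A p.1 p.2 | p : 'I_b * 'I_k] (iota 0 (b * k)).
Proof.
move=> f_inj f_lt.
have card_index : #|{: 'I_b * 'I_k}| = b * k by rewrite card_prod !card_ord.
rewrite -card_index; apply: perm_eq_image_iota => [[i1 j1] [i2 j2]|[i j]] /=.
  rewrite !mxE => /(f_inj _ _ (column_major_lt i1 j1) (column_major_lt i2 j2)).
  move=> eq_index; have := congr1 (divn^~ b) eq_index.
  have := congr1 (modn^~ b) eq_index.
  by rewrite /= !divnMDl_small ?modnMDl_small // => /val_inj-> /val_inj->.
by rewrite mxE card_index f_lt // column_major_lt.
Qed.

(* Rows and columns are indexed from 0, so A i j stands for a_{i+1,j+1}. *)
Theorem theorem5 (b : nat) (hb : 2 <= b) (k : nat) (hk : 0 < k) :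
  exists A : 'M[nat]_(b, k),
    [/\ perm_eq [seq A p.1 p.2 | p : 'I_b * 'I_k] (iota 0 (b * k)),
        (forall j : 'I_k, A (first_row hb) j = j),
        (forall (i : 'I_b) (j : 'I_k), digit_le b (A (first_row hb) j) (A i j)) &
        (forall (i : 'I_b) (j : 'I_k),
            [/\ A (first_row hb) j <= A i j,
                sum_of_powers b i (A i j - A (first_row hb) j) &
                digit_sum b (A i j) = digit_sum b (A (first_row hb) j) + i])].
Proof.
pose A := column_major_mx b k (arrangement b (b * k) (b * k)).
have A_excess (i : 'I_b) (j : 'I_k) : digit_excess b j (A i j) i.
  have := arrangement_excess hb (ltnW (ltn_expl _ hb)) (column_major_lt i j).
  by rewrite mxE divnMDl_small ?modnMDl_small.
have A_first (j : 'I_k) : A (first_row hb) j = j.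
  exact: digit_excess0_eq (A_excess (first_row hb) j).
exists A; split=> // [|i j|i j].
- have b_gt0 := ltnW hb.
  apply: perm_eq_column_major_mx => [|p]; first exact: arrangement_inj.
  exact: arrangement_lt.
- by rewrite A_first; case: (A_excess i j).
- have [le_digit sum_digit] := A_excess i j; rewrite A_first; split=> //.
    exact: digit_le_leq le_digit.
  exact: digit_excess_sum_of_powers (A_excess i j).
Qed.
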